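(* Let $n\geq 3$ and let $C\in\mathbb{R}^{n\times n}$ be row-stochastic, irreducible, and with zero diagonal. Consider the single-timescale DF dynamical system $x(t+1)=F(x(t))$ on $\Delta_n$, where $F(x)=C^\top(x-x^2)+x^2$. If $C$ has star topology with center node $1$, then (i) (Equilibria) the fixed points of $F$ in $\Delta_n$ are exactly the autocratic vertices $\{e_1,\dots,e_n\}$; and (ii) (Convergence) for every non-autocratic initial condition $x(0)\in\Delta_n\setminus\{e_1,\dots,e_n\}$, the self-weights $x(t)$ converge asymptotically to the autocratic configuration $e_1$ as $t\to\infty$.
   Context: $\Delta_n=\{x\in\mathbb{R}^n : x_i\geq 0 \text{ for all } i,\ \sum_i x_i=1\}$ is the simplex and $e_1,\dots,e_n$ are the standard basis vectors of $\mathbb{R}^n$ (the vertices of $\Delta_n$, called autocratic configurations). For a vector $x$, $x^2=(x_1^2,\dots,x_n^2)^\top$ denotes the entrywise square. A matrix is row-stochastic if its entries are non-negative and each row sums to $1$. The single-timescale DF (DeGroot-Friedkin) model with relative interaction matrix $C$ is $x(t+1)=F(x(t))=C^\top(x(t)-x(t)^2)+x(t)^2$ for $t=0,1,2,\dots$, with $x(t)\in\Delta_n$; equivalently $x(t+1)=W(x(t))^\top x(t)$ with $W(x)=\operatorname{diag}(x)+(I_n-\operatorname{diag}(x))C$. The digraph $G(C)$ associated to $C$ has nodes $\{1,\dots,n\}$ and a directed edge $(i,j)$ whenever $c_{ij}>0$. $C$ (or $G(C)$) has star topology with center node $i$ if every directed edge of $G(C)$ is either from node $i$ or to node $i$. 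*)

(* Defs.v *)
From HB Require Import structures.
From mathcomp Require Import all_boot all_order all_algebra.
From mathcomp Require Import all_classical all_reals all_analysis.

Set Implicit Arguments.
Unset Strict Implicit.
Unset Printing Implicit Defensive.

Import Order.TTheory GRing.Theory Num.Theory.
Import numFieldNormedType.Exports.

Local Open Scope classical_set_scope.
Local Open Scope ring_scope.

Definition simplex (R : realType) (n : nat) : set 'cV[R]_n :=
  [set x | (forall i, 0 <= x i 0) /\ \sum_i x i 0 = 1].

Definition autocratic (R : realType) (n : nat) (i : 'I_n) : 'cV[R]_n :=
  delta_mx i 0.

Definition row_stochastic (R : realType) (n : nat) (C : 'M[R]_n) : Prop :=
  (forall i j, 0 <= C i j) /\ (forall i, \sum_j C i j = 1).

Definition zero_diagonal (R : realType) (n : nat) (C : 'M[R]_n) : Prop :=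
  forall i, C i i = 0.

(* The digraph G(C): node set 'I_n, edge (i, j) when C i j > 0. *)
Definition edge (R : realType) (n : nat) (C : 'M[R]_n) : rel 'I_n :=
  [rel i j | 0 < C i j].

(* For a nonnegative square matrix, irreducibility is strong connectivity of
   its digraph; [irreducible_mxP] relates it to the absence of an invariant
   proper block. *)
Definition irreducible_mx (R : realType) (n : nat) (C : 'M[R]_n) : Prop :=
  forall i j, connect (edge C) i j.

Lemma irreducible_mxP (R : realType) (n : nat) (C : 'M[R]_n) :
  (forall i j, 0 <= C i j) ->
  irreducible_mx C <->
  (forall S : {set 'I_n}, (exists i, i \in S) -> (exists j, j \notin S) ->
     exists i j, [/\ i \in S, j \notin S & C i j != 0]).
Proof.
move=> C_ge0; split=> [C_irr S [i iS] [j jNS]|C_irr i j].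
  apply: contrapT => noedge; move/negP: jNS; apply.
  have clS k l : edge C k l -> k \in S -> l \in S.
    move=> /= kl kS; apply: contrapT => /negP lNS.
    by apply: noedge; exists k, l; split; rewrite // gt_eqF.
  have /connectP[p + ->] := C_irr i j.
  elim: p i iS => //= k p IHp i iS /andP[ik kp].
  exact: IHp (clS _ _ ik iS) kp.
apply: contrapT => /negP ijN.
have [||k [l []]] := C_irr [set k | connect (edge C) i k]%SET.
- by exists i; rewrite inE.
- by exists j; rewrite inE.
rewrite !inE => ik /negP ilN Ckl; apply: ilN; apply: connect_trans ik _.
by apply: connect1; rewrite /edge /= lt_def Ckl C_ge0.
Qed.

Definition star_topology (R : realType) (n : nat) (C : 'M[R]_n) (c : 'I_n) :
  Prop := forall i j, edge C i j -> i = c \/ j = c.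

Definition sqr_entries (R : realType) (n : nat) (x : 'cV[R]_n) : 'cV[R]_n :=
  map_mx (fun a => a ^+ 2) x.

Definition DF_map (R : realType) (n : nat) (C : 'M[R]_n) (x : 'cV[R]_n) :
  'cV[R]_n :=
  C^T *m (x - sqr_entries x) + sqr_entries x.

Definition DF_trajectory (R : realType) (n : nat) (C : 'M[R]_n)
  (x : nat -> 'cV[R]_n) : Prop :=
  forall t, x t.+1 = DF_map C (x t).

(* Main.v *)
Require Import Defs.
From HB Require Import structures.
From mathcomp Require Import all_boot all_order all_algebra.
From mathcomp Require Import all_classical all_reals all_analysis.
From mathcomp Require Import lra.

Set Implicit Arguments.
Unset Strict Implicit.
Unset Printing Implicit Defensive.

Import Order.TTheory GRing.Theory Num.Theory.
Import numFieldNormedType.Exports.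

Local Open Scope classical_set_scope.
Local Open Scope ring_scope.

(** In a star with center [c], every leaf gives all its weight to [c], and [c]
    distributes its weight over the leaves with coefficients [p_j = C c j],
    all positive by irreducibility. The system therefore reads
      [x_c' = x_c^2 + sum_(j != c) (x_j - x_j^2)],
      [x_j' = p_j (x_c - x_c^2) + x_j^2] for a leaf [j].
    Since the leaves carry total weight [1 - x_c], the gain of the center is
      [x_c' - x_c = sum_(j != c) x_j (1 - x_c - x_j)
                  = sum of x_j x_k over ordered pairs of distinct leaves],
    which is nonnegative and dominates every product [x_j x_k]
    ([center_gain_ge]). As [n >= 3] there are two distinct leaves, and both
    conclusions follow from the fact that one step of the dynamics makes every
    leaf positive as soon as [0 < x_c < 1] ([DF_map_leaf_ge]).

    Fixed points: the gain vanishes, so two leaves cannot both be positive,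
    hence [x_c] is [0] or [1]; then every leaf satisfies [x_j = x_j^2], and a
    point of the simplex with entries in {0, 1} is a vertex.

    Convergence: the weight of the center is nondecreasing and bounded by [1],
    so it has a limit [L]; off the vertices it is positive after one step. If
    [L < 1], then [x_c - x_c^2] is bounded below by a positive constant along
    the trajectory, hence so are the leaves one step later, hence so is the
    gain of the center in the next step ([star_gain_two_steps]), contradicting
    convergence. So [L = 1], and the constraint that the entries sum to [1]
    forces the leaves to vanish in the limit. *)

(** * The simplex *)
Lemma simplex_entry_le1 (R : realType) (n : nat) (x : 'cV[R]_n) (i : 'I_n) :
  simplex x -> x i 0 <= 1.
Proof.
by move=> [x_ge0 <-]; rewrite (bigD1 i) //= lerDl sumr_ge0.
Qed.

Lemma simplex_add_le1 (R : realType) (n : nat) (x : 'cV[R]_n) (i j : 'I_n) :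
  simplex x -> i != j -> x i 0 + x j 0 <= 1.
Proof.
move=> [x_ge0 <-] ij; rewrite (bigD1 i) //= (bigD1 j) /=; last by rewrite eq_sym.
by rewrite addrA lerDl sumr_ge0.
Qed.

Lemma simplex_add3_le1 (R : realType) (n : nat) (x : 'cV[R]_n) (i j k : 'I_n) :
  simplex x -> i != j -> i != k -> j != k -> x i 0 + x j 0 + x k 0 <= 1.
Proof.
move=> [x_ge0 <-] ij ik jk.
rewrite (bigD1 i) //= (bigD1 j) /=; last by rewrite eq_sym.
rewrite (bigD1 k) /=; last by rewrite ![k == _]eq_sym ik.
by rewrite !addrA lerDl sumr_ge0.
Qed.

Lemma simplex_entry1 (R : realType) (n : nat) (x : 'cV[R]_n) (i : 'I_n) :
  simplex x -> x i 0 = 1 -> x = autocratic R i.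
Proof.
move=> sx xi; apply/colP => j; rewrite mxE eqxx andbT.
have [->//|ji] := eqVneq j i.
apply/le_anti; rewrite /= mulr0n sx.1 andbT.
by have := simplex_add_le1 sx ji; lra.
Qed.

(** The hypothesis [x_i = x_i^2] says that every entry is [0] or [1]; not all of
    them vanish because they sum to [1]. *)
Lemma simplex_01 (R : realType) (n : nat) (x : 'cV[R]_n) :
  simplex x -> (forall i, x i 0 - x i 0 ^+ 2 = 0) ->
  exists i, x = autocratic R i.
Proof.
move=> sx x01; apply: contrapT => x_nvertex.
have x0 i : x i 0 = 0.
  have /eqP := x01 i.
  rewrite expr2 -{1}[x i 0]mulr1 -mulrBr mulf_eq0 subr_eq0 => /orP[/eqP//|].
  move=> /eqP xi; case: x_nvertex; exists i.
  exact: simplex_entry1.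
by have := sx.2; rewrite big1// => /esym/eqP; rewrite oner_eq0.
Qed.

Lemma subr_sqr_ge0 (R : realType) (n : nat) (x : 'cV[R]_n) (i : 'I_n) :
  simplex x -> 0 <= x i 0 - x i 0 ^+ 2.
Proof.
move=> sx; have := sx.1 i; have := simplex_entry_le1 i sx.
by rewrite expr2 => ? ?; nra.
Qed.

(** The weight missing from entry [c], namely [1 - x_c], bounds all the other
    entries uniformly, so convergence of one entry gives convergence of the
    vector. *)
Lemma simplex_cvg_autocratic (R : realType) (n : nat) (c : 'I_n)
  (x : nat -> 'cV[R]_n) :
  (forall t, simplex (x t)) -> x t c 0 @[t --> \oo] --> (1 : R) ->
  x t @[t --> \oo] --> autocratic R c.
Proof.
move=> sx /cvgrPdist_lt x1; apply/cvg_ballP => e e0.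
near=> t.
have xt : `|1 - x t c 0| < e by near: t; exact: x1.
have xc1 := simplex_entry_le1 c (sx t).
have x0 := (sx t).1.
rewrite ger0_norm ?subr_ge0// in xt.
split=> // i j; rewrite ord1 mxE eqxx andbT /ball/=.
have [->|ic] := eqVneq i c; first by rewrite ger0_norm ?subr_ge0.
rewrite sub0r normrN ger0_norm//; apply: le_lt_trans xt.
by have := simplex_add_le1 (sx t) ic; lra.
Unshelve. all: by end_near.
Qed.

(** * The map on the simplex *)
Lemma DF_mapE (R : realType) (n : nat) (C : 'M[R]_n) (x : 'cV[R]_n) (i : 'I_n) :
  DF_map C x i 0 = \sum_j C j i * (x j 0 - x j 0 ^+ 2) + x i 0 ^+ 2.
Proof. by rewrite !mxE; congr (_ + _); apply: eq_bigr => j _; rewrite !mxE. Qed.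

Lemma DF_map_simplex (R : realType) (n : nat) (C : 'M[R]_n) (x : 'cV[R]_n) :
  row_stochastic C -> simplex x -> simplex (DF_map C x).
Proof.
move=> [C_ge0 C_sum] sx; split=> [i|].
  rewrite DF_mapE addr_ge0 ?sqr_ge0// sumr_ge0// => j _.
  by rewrite mulr_ge0 ?subr_sqr_ge0.
under eq_bigr do rewrite DF_mapE.
rewrite big_split/= exchange_big/= -sx.2 -big_split/=; apply: eq_bigr => j _.
by rewrite -mulr_suml C_sum mul1r subrK.
Qed.

Lemma autocratic_simplex (R : realType) (n : nat) (i : 'I_n) :
  simplex (autocratic R i).
Proof.
split=> [j|]; first by rewrite mxE ler0n.
rewrite (bigD1 i)//= big1 ?addr0 ?mxE ?eqxx// => j /negbTE ji.
by rewrite mxE ji.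
Qed.

(** Vertices have entries in {0, 1}, so [x - x^2] vanishes there. *)
Lemma DF_map_autocratic (R : realType) (n : nat) (C : 'M[R]_n) (i : 'I_n) :
  DF_map C (autocratic R i) = autocratic R i.
Proof.
have sqrE : sqr_entries (autocratic R i) = autocratic R i.
  by apply/colP => j; rewrite !mxE -natrX; case: (_ && _).
by rewrite /DF_map sqrE subrr mulmx0 add0r.
Qed.

(** * The interaction matrix of a star *)
Lemma star_leaf_leaf (R : realType) (n : nat) (C : 'M[R]_n) (c j k : 'I_n) :
  row_stochastic C -> star_topology C c -> j != c -> k != c -> C j k = 0.
Proof.
move=> [C_ge0 _] C_star jc kc; apply/le_anti; rewrite C_ge0 andbT leNgt.
by apply/negP => /C_star[] /eqP; apply/negP.
Qed.

Lemma star_leaf_center (R : realType) (n : nat) (C : 'M[R]_n) (c j : 'I_n) :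
  row_stochastic C -> star_topology C c -> j != c -> C j c = 1.
Proof.
move=> C_stoch C_star jc; rewrite -(C_stoch.2 j) (bigD1 c)//= big1 ?addr0// => k.
exact: star_leaf_leaf.
Qed.

(** Irreducibility provides an edge entering the leaf [j], and in a star such
    an edge can only start at the center. *)
Lemma star_center_leaf_gt0 (R : realType) (n : nat) (C : 'M[R]_n)
  (c j : 'I_n) :
  row_stochastic C -> irreducible_mx C -> star_topology C c -> j != c ->
  0 < C c j.
Proof.
move=> [C_ge0 _] /(irreducible_mxP C_ge0) C_irr C_star jc.
have [||i [k []]] := C_irr (~: [set j])%SET.
- by exists c; rewrite !inE eq_sym.
- by exists j; rewrite !inE eqxx.
rewrite !inE negbK => _ /eqP -> Cij.
have Cij_gt0 : 0 < C i j by rewrite lt_def Cij C_ge0.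
by have [<-//|/eqP] := C_star _ _ Cij_gt0; rewrite (negbTE jc).
Qed.

(** * The dynamics on a star *)
Lemma DF_map_center (R : realType) (n : nat) (C : 'M[R]_n) (c : 'I_n)
  (x : 'cV[R]_n) :
  row_stochastic C -> zero_diagonal C -> star_topology C c ->
  DF_map C x c 0 = \sum_(j | j != c) (x j 0 - x j 0 ^+ 2) + x c 0 ^+ 2.
Proof.
move=> C_stoch C_diag C_star; rewrite DF_mapE (bigD1 c)//= C_diag mul0r add0r.
congr (_ + _); apply: eq_bigr => j jc.
by rewrite (star_leaf_center C_stoch C_star jc) mul1r.
Qed.

Lemma DF_map_leaf (R : realType) (n : nat) (C : 'M[R]_n) (c j : 'I_n)
  (x : 'cV[R]_n) :
  row_stochastic C -> star_topology C c -> j != c ->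
  DF_map C x j 0 = C c j * (x c 0 - x c 0 ^+ 2) + x j 0 ^+ 2.
Proof.
move=> C_stoch C_star jc; rewrite DF_mapE (bigD1 c)//= big1 ?addr0// => k kc.
by rewrite (star_leaf_leaf C_stoch C_star kc jc) mul0r.
Qed.

(** This rearranges the two sums with [sum_(j != c) x_j = 1 - x_c]. Each
    factor [1 - x_c - x_j] is the total weight of the leaves other than [j],
    hence the sign of the gain and its lower bound by products of leaves. *)
Lemma center_gainE (R : realType) (n : nat) (C : 'M[R]_n) (c : 'I_n)
  (x : 'cV[R]_n) :
  row_stochastic C -> zero_diagonal C -> star_topology C c -> simplex x ->
  DF_map C x c 0 - x c 0 = \sum_(j | j != c) x j 0 * (1 - x c 0 - x j 0).
Proof.
move=> C_stoch C_diag C_star sx; rewrite DF_map_center//.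
have sum_leaves : \sum_(j | j != c) x j 0 = 1 - x c 0.
  by rewrite -sx.2 [in RHS](bigD1 c)//= addrAC subrr add0r.
rewrite [RHS](eq_bigr (fun j => (x j 0 - x j 0 ^+ 2) - x j 0 * x c 0)).
  by rewrite [RHS]sumrB -[in RHS]mulr_suml sum_leaves expr2; lra.
by move=> j _; rewrite expr2; lra.
Qed.

Lemma center_le_DF_map (R : realType) (n : nat) (C : 'M[R]_n) (c : 'I_n)
  (x : 'cV[R]_n) :
  row_stochastic C -> zero_diagonal C -> star_topology C c -> simplex x ->
  x c 0 <= DF_map C x c 0.
Proof.
move=> C_stoch C_diag C_star sx; rewrite -subr_ge0 center_gainE//.
apply: sumr_ge0 => j jc; apply: mulr_ge0; first exact: sx.1.
by have := simplex_add_le1 sx jc; lra.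
Qed.

Lemma center_gain_ge (R : realType) (n : nat) (C : 'M[R]_n) (c j k : 'I_n)
  (x : 'cV[R]_n) :
  row_stochastic C -> zero_diagonal C -> star_topology C c -> simplex x ->
  j != c -> k != c -> j != k ->
  x j 0 * x k 0 <= DF_map C x c 0 - x c 0.
Proof.
move=> C_stoch C_diag C_star sx jc kc jk.
rewrite center_gainE// (bigD1 j)//= -[leLHS]addr0 lerD//.
  rewrite ler_wpM2l ?sx.1//.
  by have := simplex_add3_le1 sx jc jk; rewrite eq_sym => /(_ kc); lra.
apply: sumr_ge0 => i /andP[ic _]; apply: mulr_ge0; first exact: sx.1.
by have := simplex_add_le1 sx ic; lra.
Qed.

Lemma DF_map_leaf_ge (R : realType) (n : nat) (C : 'M[R]_n) (c j : 'I_n)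
  (x : 'cV[R]_n) :
  row_stochastic C -> star_topology C c -> j != c ->
  C c j * (x c 0 - x c 0 ^+ 2) <= DF_map C x j 0.
Proof. by move=> ? ? jc; rewrite (DF_map_leaf _ _ _ jc)// lerDl sqr_ge0. Qed.

(** If the center has no weight before and after the step, then the sum of the
    [x_j - x_j^2] over the leaves vanishes, which only happens at a vertex. *)
Lemma DF_map_center_gt0 (R : realType) (n : nat) (C : 'M[R]_n) (c : 'I_n)
  (x : 'cV[R]_n) :
  row_stochastic C -> zero_diagonal C -> star_topology C c -> simplex x ->
  (forall i, x <> autocratic R i) -> 0 < DF_map C x c 0.
Proof.
move=> C_stoch C_diag C_star sx x_nvertex.
have sy := DF_map_simplex C_stoch sx.
rewrite lt_def sy.1 andbT; apply/eqP => yc0.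
have xc0 : x c 0 = 0.
  apply/le_anti; rewrite sx.1 andbT -yc0.
  exact: center_le_DF_map.
have [i xi] : exists i, x = autocratic R i; last exact: x_nvertex xi.
apply: simplex_01 => // i; have [->|ic] := eqVneq i c.
  by rewrite xc0 expr0n subr0.
move: yc0; rewrite DF_map_center// xc0 expr0n addr0 => /eqP.
rewrite psumr_eq0 => [/allP/(_ i)|j _]; last exact: subr_sqr_ge0.
by rewrite mem_index_enum ic => /(_ isT)/eqP.
Qed.

Lemma two_leaves (n : nat) (c : 'I_n) :
  (3 <= n)%N -> exists j k, [/\ j != c, k != c & j != k].
Proof.
move=> n_ge3; have : (1 < #|[set~ c]%SET|)%N.
  by rewrite cardsC1 card_ord; case: n n_ge3 c => [|[]].
by move=> /card_gt1P[j [k [jc kc jk]]]; exists j, k; rewrite !inE in jc kc.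
Qed.

(** * Fixed points and convergence *)

(** If [0 < x_c < 1], all leaves of a fixed point are positive, so the gain of
    the center is positive too, which a fixed point excludes. *)
Lemma star_fixed_autocratic (R : realType) (n : nat) (C : 'M[R]_n) (c : 'I_n)
  (x : 'cV[R]_n) :
  (3 <= n)%N -> row_stochastic C -> irreducible_mx C -> zero_diagonal C ->
  star_topology C c -> simplex x -> DF_map C x = x ->
  exists i, x = autocratic R i.
Proof.
move=> n_ge3 C_stoch C_irr C_diag C_star sx Fx.
have [xc|xc] := eqVneq (x c 0 - x c 0 ^+ 2) 0.
  apply: simplex_01 => // i; have [->//|ic] := eqVneq i c.
  have := congr1 (fun y : 'cV_n => y i 0) Fx.
  by rewrite /= (DF_map_leaf _ C_stoch C_star ic) xc mulr0 add0r => ->;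
     rewrite subrr.
have [j [k [jc kc jk]]] := two_leaves c n_ge3.
have leaf_gt0 l : l != c -> 0 < x l 0.
  move=> lc; rewrite -Fx; apply: lt_le_trans (DF_map_leaf_ge x C_stoch C_star lc).
  by rewrite mulr_gt0 ?(star_center_leaf_gt0 C_stoch C_irr C_star)//
    lt_def xc subr_sqr_ge0.
have := center_gain_ge C_stoch C_diag C_star sx jc kc jk.
by rewrite Fx subrr leNgt mulr_gt0 ?leaf_gt0.
Qed.

(** A lower bound that is uniform along a trajectory whose center stays in
    [[m, L]]: first each leaf [l] receives at least [p_l m (1 - L)], then the
    center gains at least the product of two leaves. *)
Lemma star_gain_two_steps (R : realType) (n : nat) (C : 'M[R]_n)
  (c j k : 'I_n) (m L : R) (x : 'cV[R]_n) :
  row_stochastic C -> zero_diagonal C -> star_topology C c -> simplex x ->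
  j != c -> k != c -> j != k -> 0 <= m -> L <= 1 -> m <= x c 0 -> x c 0 <= L ->
  C c j * C c k * (m * (1 - L)) ^+ 2
    <= DF_map C (DF_map C x) c 0 - DF_map C x c 0.
Proof.
move=> C_stoch C_diag C_star sx jc kc jk m0 L1 mx xL.
have sy := DF_map_simplex C_stoch sx.
apply: le_trans (center_gain_ge C_stoch C_diag C_star sy jc kc jk).
have C_ge0 := C_stoch.1.
have mL0 : 0 <= m * (1 - L) by rewrite mulr_ge0// subr_ge0.
have mLx : m * (1 - L) <= x c 0 - x c 0 ^+ 2.
  rewrite expr2 -{1}[x c 0]mulr1 -mulrBr ler_pM ?subr_ge0//.
  by rewrite lerB.
have leaf_ge l : l != c -> C c l * (m * (1 - L)) <= DF_map C x l 0.
  move=> lc; apply: le_trans (DF_map_leaf_ge x C_stoch C_star lc).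
  exact: ler_wpM2l.
by rewrite expr2 mulrACA ler_pM ?leaf_ge// mulr_ge0.
Qed.

(** The center weight is monotone and bounded; a limit below [1] would let it
    gain a fixed positive amount at every step. *)
Lemma star_center_cvg1 (R : realType) (n : nat) (C : 'M[R]_n) (c : 'I_n)
  (x : nat -> 'cV[R]_n) :
  (3 <= n)%N -> row_stochastic C -> irreducible_mx C -> zero_diagonal C ->
  star_topology C c -> DF_trajectory C x -> (forall t, simplex (x t)) ->
  (forall i, x 0%N <> autocratic R i) ->
  x t c 0 @[t --> \oo] --> (1 : R).
Proof.
move=> n_ge3 C_stoch C_irr C_diag C_star xS sx x0.
pose s t := x t c 0.
have s_nd : nondecreasing_seq s.
  by apply/nondecreasing_seqP => t; rewrite /s xS; exact: center_le_DF_map.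
have s_ub : has_ubound (range s).
  by exists 1 => _ [t _ <-]; exact: simplex_entry_le1.
have /cvg_ex[L sL] : cvgn s := nondecreasing_is_cvgn s_nd s_ub.
suff <- : L = 1 by [].
have s_le t : s t <= L.
  rewrite -(cvg_lim _ sL)//; apply: nondecreasing_cvgn_le => //.
  by apply/cvg_ex; exists L.
have L1 : L <= 1.
  rewrite -(cvg_lim _ sL)//; apply: limr_le; first by apply/cvg_ex; exists L.
  by apply: nearW => t; exact: simplex_entry_le1.
apply/eqP; rewrite eq_le L1/= leNgt; apply/negP => L_lt1.
have [j [k [jc kc jk]]] := two_leaves c n_ge3.
(* The lower bound is taken at time 1: the center may start without weight. *)
have s1_gt0 : 0 < s 1%N by rewrite /s xS; exact: DF_map_center_gt0.
pose d := C c j * C c k * (s 1%N * (1 - L)) ^+ 2.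
have d_gt0 : 0 < d.
  by rewrite !mulr_gt0 ?exprn_gt0 ?mulr_gt0 ?subr_gt0//;
    exact: (star_center_leaf_gt0 C_stoch C_irr C_star).
have d_le t : d <= s t.+3 - s t.+2.
  rewrite /s !(xS t.+2) !(xS t.+1).
  apply: star_gain_two_steps => //; first exact: ltW.
    exact: (s_nd 1%N t.+1).
  exact: s_le t.+1.
have sp : s t.+3 - s t.+2 @[t --> \oo] --> L - L.
  apply: cvgB.
    by have := sL; rewrite -(cvg_shiftn 3%N); under eq_fun do rewrite addn3.
  by have := sL; rewrite -(cvg_shiftn 2%N); under eq_fun do rewrite addn2.
have : d <= L - L.
  rewrite -(cvg_lim _ sp)//; apply: limr_ge; last exact: nearW.
  by apply/cvg_ex; exists (L - L).
by rewrite subrr leNgt d_gt0.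
Qed.

Theorem mainTheorem1 (R : realType) (n : nat) (n_ge3 : (3 <= n)%N)
  (C : 'M[R]_n) (C_stoch : row_stochastic C) (C_irr : irreducible_mx C)
  (C_diag : zero_diagonal C)
  (node1 : 'I_n) (node1E : nat_of_ord node1 = 0%N)
  (C_star : star_topology C node1) :
  [set x : 'cV[R]_n | simplex x /\ DF_map C x = x]
    = [set autocratic R i | i in [set: 'I_n]]
  /\
  (forall x : nat -> 'cV[R]_n,
     DF_trajectory C x ->
     simplex (x 0%N) -> (forall i, x 0%N <> autocratic R i) ->
     x t @[t --> \oo] --> autocratic R node1).
Proof.
split=> [|x xS sx0 x0].
  apply/seteqP; split=> [x [sx Fx]|_ [i _ <-]]; last first.
    split; [exact: autocratic_simplex|exact: DF_map_autocratic].
  have [i ->] := star_fixed_autocratic n_ge3 C_stoch C_irr C_diag C_star sx Fx.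
  by exists i.
have sx t : simplex (x t).
  by elim: t => // t IHt; rewrite xS; exact: DF_map_simplex.
by apply: simplex_cvg_autocratic => //; exact: star_center_cvg1 xS sx x0.
Qed.
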